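(* For every integer $r\geq 2$ and every sequence $(x_n)_{n\geq 1}$ of distinct points on the circle $\mathbb T=\mathbb R/\mathbb Z$, $$\limsup_{n\to\infty}\frac{M_n^{(r)}}{m_n^{(r)}}\geq 1+\frac{r}{r^2-1}.$$
   Context: Let $x_1,x_2,x_3,\ldots$ be a sequence of distinct points on the circle $\mathbb T=\mathbb R/\mathbb Z$ (of total length $1$). For each $n\ge 1$, the first $n$ points $x_1,\dots,x_n$ divide the circle into $n$ intervals, whose lengths in cyclic order are written $g_1^{(n)},g_2^{(n)},\ldots,g_n^{(n)}$. For a positive integer $r$, define $$M_n^{(r)}=\max_i\left(g_i^{(n)}+g_{i+1}^{(n)}+\cdots+g_{i+r-1}^{(n)}\right),\qquad m_n^{(r)}=\min_i\left(g_i^{(n)}+g_{i+1}^{(n)}+\cdots+g_{i+r-1}^{(n)}\right),$$ where indices are taken cyclically (modulo $n$). Thus $M_n^{(r)}$ and $m_n^{(r)}$ are the largest and smallest total lengths of $r$ consecutive intervals. *)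

(* Defs.v *)
From HB Require Import structures.
From mathcomp Require Import all_boot all_order all_algebra.
From mathcomp Require Import generic_quotient.
From mathcomp Require Import all_classical all_reals all_analysis.
Set Implicit Arguments.
Unset Strict Implicit.
Unset Printing Implicit Defensive.
Import Order.TTheory GRing.Theory Num.Theory.
Local Open Scope ring_scope.
Local Open Scope quotient_scope.

Definition eqmod1 (R : realType) (a b : R) : bool := a - b \is a Num.int.

Lemma eqmod1_refl (R : realType) : reflexive (@eqmod1 R).
Proof. by move=> a; rewrite /eqmod1 subrr rpred0. Qed.

Lemma eqmod1_sym (R : realType) : symmetric (@eqmod1 R).
Proof. by move=> a b; rewrite /eqmod1 -rpredN opprB. Qed.

Lemma eqmod1_trans (R : realType) : transitive (@eqmod1 R).
Proof. by move=> b a c ab bc; rewrite /eqmod1 -(subrKA b a (- c)) rpredD. Qed.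

Canonical eqmod1_equiv (R : realType) :=
  EquivRel (@eqmod1 R) (@eqmod1_refl R) (@eqmod1_sym R) (@eqmod1_trans R).

(* R / Z as a genuine quotient type: equality of classes is congruence mod 1 *)
Definition circle (R : realType) : Type := {eq_quot (@eqmod1_equiv R)}.

(* the representative in [0, 1); it does not depend on the lift chosen by repr *)
Definition circle_coord (R : realType) (p : circle R) : R :=
  repr p - (Num.floor (repr p))%:~R.

(* The sequence is indexed from 0, so the first n points are x 0, ..., x n.-1. *)
Definition sorted_coords (R : realType) (x : nat -> circle R) (n : nat) : seq R :=
  sort <=%R [seq circle_coord (x k) | k <- iota 0 n].

(* gap x n i for i < n; the last gap, i = n.-1, passes through 0 = 1 in R / Z,
   and for n = 1 it is the whole circle, of length 1. *)
Definition gap (R : realType) (x : nat -> circle R) (n i : nat) : R :=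
  let s := sorted_coords x n in
  if (i.+1 < n)%N then s`_i.+1 - s`_i else 1 + s`_0 - s`_i.

Definition window (R : realType) (x : nat -> circle R) (r n i : nat) : R :=
  \sum_(j < r) gap x n ((i + j) %% n)%N.

(* The starting value is window 0, one of the windows as soon as 0 < n. *)
Definition max_window (R : realType) (x : nat -> circle R) (r n : nat) : R :=
  \big[Num.max/window x r n 0]_(i < n) window x r n i.

Definition min_window (R : realType) (x : nat -> circle R) (r n : nat) : R :=
  \big[Num.min/window x r n 0]_(i < n) window x r n i.

(* Main.v *)
(** Let M_n and m_n be the extreme lengths of r consecutive gaps and suppose
    M_n <= rho m_n eventually, with rho below the claimed bound. Call the step
    from n to n+1 good if m_{n+1} >= mu M_n, where mu is slightly less than
    1 / rho. At a good step, comparing r-windows before and after the insertion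
    shows that the r new gaps on either side of the inserted point are at most
    (1 - mu) M_n, while the gap that was split is larger than
    (1 - mu) M_n / lam, for some lam < r / (r + 1). So as long as M stays above
    lam M_n, no later good insertion falls among those 2r gaps, and the good
    points stay separated by r + 1 gaps: at most a fraction 1 / (r + 1) of the
    points come from good steps. Bad steps are boundedly many, since each
    multiplies M by at most rho mu < 1. Hence M drops by the factor lam while n
    grows by a factor of about (r + 1) / r only; iterating contradicts
    M_n >= r / n.

    Gaps and windows are handled on the real line: a window of r gaps is a pair
    of lifts a < b of the points with exactly r lifts in ]a, b], and lifts are
    counted by a sum of floors. *)

Require Import Defs.
From HB Require Import structures.
From mathcomp Require Import all_boot all_order all_algebra.
From mathcomp Require Import all_classical all_reals all_analysis.
From mathcomp Require Import zify ring lra.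
Set Implicit Arguments.
Unset Strict Implicit.
Unset Printing Implicit Defensive.
Import Order.TTheory GRing.Theory Num.Theory.
Local Open Scope ring_scope.

(** * Lifts of the points to the real line, and how to count them *)

Definition is_lift {R : realType} (c : nat -> R) (n : nat) (z : R) : Prop :=
  exists2 k, (k < n)%N & z - c k \is a Num.int.

(* The number of lifts in ]a, b] is lift_count c n b - lift_count c n a. *)
Definition lift_count {R : realType} (c : nat -> R) (n : nat) (z : R) : int :=
  \sum_(k < n) Num.floor (z - c k).

Definition incongruent {R : realType} (c : nat -> R) : Prop :=
  forall i j, c i - c j \is a Num.int -> i = j.

Lemma lift_countS (R : realType) (c : nat -> R) n z :
  lift_count c n.+1 z = lift_count c n z + Num.floor (z - c n).
Proof. by rewrite /lift_count big_ord_recr. Qed.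

Lemma lift_count_le (R : realType) (c : nat -> R) n a b :
  a <= b -> lift_count c n a <= lift_count c n b.
Proof. by move=> ab; apply: ler_sum => k _; apply: le_floor; lra. Qed.

Lemma floor_int_lt (R : realType) (a b : R) :
  b \is a Num.int -> a < b -> Num.floor a < Num.floor b.
Proof. by move=> bZ ab; rewrite floor_lt_int floorK. Qed.

Lemma lift_count_lt (R : realType) (c : nat -> R) n a b :
  is_lift c n b -> a < b -> lift_count c n a < lift_count c n b.
Proof.
move=> [k kn bk] ab; rewrite /lift_count (bigD1 (Ordinal kn)) //=.
rewrite [ltRHS](bigD1 (Ordinal kn)) //=; apply: ltr_leD.
  by apply: floor_int_lt => //; lra.
by apply: ler_sum => i _; apply: le_floor; lra.
Qed.

Lemma lift_count_inj (R : realType) (c : nat -> R) n a b :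
  is_lift c n a -> is_lift c n b -> lift_count c n a = lift_count c n b ->
  a = b.
Proof.
move=> la lb ab; case: (ltgtP a b) => // h.
  by have := lift_count_lt lb h; rewrite ab ltxx.
by have := lift_count_lt la h; rewrite ab ltxx.
Qed.

Lemma lift_of_count_le (R : realType) (c : nat -> R) n a b :
  is_lift c n a -> lift_count c n a <= lift_count c n b -> a <= b.
Proof. by move=> la; apply: contraTT; rewrite -!ltNge; exact: lift_count_lt. Qed.

Lemma lift_of_count_lt (R : realType) (c : nat -> R) n a b :
  lift_count c n a < lift_count c n b -> a < b.
Proof. by apply: contraTT; rewrite -!leNgt; exact: lift_count_le. Qed.

Lemma is_liftD (R : realType) (c : nat -> R) n z a :
  a \is a Num.int -> is_lift c n z -> is_lift c n (z + a).
Proof. by move=> aZ [k kn zk]; exists k => //; rewrite addrAC rpredD. Qed.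

Lemma is_liftS (R : realType) (c : nat -> R) n m z :
  (n <= m)%N -> is_lift c n z -> is_lift c m z.
Proof. by move=> nm [k kn zk]; exists k => //; apply: leq_trans nm. Qed.

Lemma lift_countD (R : realType) (c : nat -> R) n z (a : int) :
  lift_count c n (z + a%:~R) = lift_count c n z + a * n%:Z.
Proof.
rewrite /lift_count (eq_bigr (fun k : 'I_n => Num.floor (z - c k) + a)).
  by rewrite big_split /= sumr_const card_ord -mulr_natr natz.
by move=> k _; rewrite addrAC floorDrz ?intr_int // intrKfloor.
Qed.

(** Each new point adds a non-negative number of lifts to []a, b]]. *)
Lemma lift_count_mono (R : realType) (c : nat -> R) n m a b :
  a <= b -> (n <= m)%N ->
  lift_count c n b - lift_count c n a <= lift_count c m b - lift_count c m a.
Proof.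
move=> ab; elim: m => [|m IH]; first by rewrite leqn0 => /eqP ->.
rewrite leq_eqVlt => /predU1P[-> //|]; rewrite ltnS => /IH.
rewrite !lift_countS.
have : Num.floor (a - c m) <= Num.floor (b - c m) by apply: le_floor; lra.
lia.
Qed.

Lemma lift_new (R : realType) (c : nat -> R) n y :
  incongruent c -> y - c n \is a Num.int -> ~ is_lift c n y.
Proof.
move=> cI yn [k kn yk]; have : c n - c k \is a Num.int.
  rewrite (_ : c n - c k = (y - c k) - (y - c n)); last by ring.
  by rewrite rpredB.
by move=> /cI nk; rewrite nk ltnn in kn.
Qed.

Lemma is_lift_old (R : realType) (c : nat -> R) n z :
  is_lift c n.+1 z -> z - c n \isn't a Num.int -> is_lift c n z.
Proof.
move=> [k]; rewrite ltnS leq_eqVlt => /predU1P[->|kn] zk.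
  by rewrite zk.
by move=> _; exists k.
Qed.

Lemma floor_sub_lift (R : realType) (z y v : R) :
  y - v \is a Num.int ->
  Num.floor (z - v) - Num.floor (y - v) = Num.floor (z - y).
Proof.
move=> yv; rewrite (_ : z - v = z - y + (y - v)); last by ring.
by rewrite floorDrz // addrK.
Qed.

(** * Circle coordinates, gaps and windows in terms of lifts *)

Definition coords {R : realType} (x : nat -> circle R) (k : nat) : R :=
  circle_coord (x k).

Lemma circle_coord_itv (R : realType) (p : circle R) :
  0 <= circle_coord p < 1.
Proof.
rewrite /circle_coord; have /andP[h1 h2] := floor_itv (repr p).
by move: h2; rewrite intrD => h2; apply/andP; split; lra.
Qed.

Lemma coords_incongruent (R : realType) (x : nat -> circle R) :
  injective x -> incongruent (coords x).
Proof.
move=> xI i j; rewrite /coords => ij; apply: xI; rewrite -[x i]reprK -[x j]reprK.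
apply/eqmodP; rewrite /= /eqmod1.
rewrite (_ : repr (x i) - repr (x j) = circle_coord (x i) - circle_coord (x j)
  + (Num.floor (repr (x i)))%:~R - (Num.floor (repr (x j)))%:~R).
  by apply: rpredB; [apply: rpredD; [exact: ij|]|]; exact: intr_int.
by rewrite /circle_coord; ring.
Qed.

Lemma size_sorted_coords (R : realType) (x : nat -> circle R) n :
  size (sorted_coords x n) = n.
Proof. by rewrite size_sort size_map size_iota. Qed.

Lemma sorted_coords_lt (R : realType) (x : nat -> circle R) n :
  injective x -> sorted <%R (sorted_coords x n).
Proof.
move=> xI; rewrite lt_sorted_uniq_le sort_le_sorted andbT sort_uniq.
rewrite map_inj_in_uniq ?iota_uniq // => i j _ _ ij.
by apply: (coords_incongruent xI); rewrite /coords ij subrr rpred0.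
Qed.

Lemma nth_sorted_coords (R : realType) (x : nat -> circle R) n i :
  (i < n)%N -> exists2 k, (k < n)%N & (sorted_coords x n)`_i = circle_coord (x k).
Proof.
move=> ni; have : (sorted_coords x n)`_i \in sorted_coords x n.
  by rewrite mem_nth ?size_sorted_coords.
rewrite {2}/sorted_coords mem_sort => /mapP[k]; rewrite mem_iota => kn ->.
by exists k.
Qed.

(** The coordinates increase within [[0, 1[], so the floor attached to index [j] is 0 when [j <= i]
    and -1 for the [n - i - 1] others. *)
Lemma lift_count_sorted (R : realType) (x : nat -> circle R) n i :
  injective x -> (i < n)%N ->
  lift_count (coords x) n (sorted_coords x n)`_i = i.+1%:Z - n%:Z.
Proof.
move=> xI ni; set s := sorted_coords x n.
have sz : size s = n := size_sorted_coords x n.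
have s_itv j : (j < n)%N -> 0 <= s`_j < 1.
  by move=> /(@nth_sorted_coords _ x)[k _ ->]; exact: circle_coord_itv.
transitivity (\sum_(v <- s) Num.floor (s`_i - v)).
  rewrite (perm_big [seq circle_coord (x k) | k <- iota 0 n]) ?perm_sort //=.
  by rewrite big_map -{2}(subn0 n) -/(index_iota 0 n) big_mkord.
rewrite (big_nth 0) sz big_mkord.
transitivity (\sum_(j < n) ((j <= i)%N%:Z - 1)).
  apply: eq_bigr => j _; apply: floor_def.
  have := s_itv i ni; have := s_itv j (ltn_ord j).
  have : (s`_j <= s`_i) = (j <= i)%N.
    by rewrite (lt_sorted_leq_nth 0 (sorted_coords_lt n xI)) // inE sz.
  case: (leqP j i) => _; case: (leP s`_j s`_i) => //= *.
    by rewrite (_ : 1%:Z - 1 = 0) //; lra.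
  by rewrite (_ : 0%:Z - 1 + 1 = 0) // (_ : 0%:Z - 1 = - 1%:Z) // mulrNz; lra.
rewrite big_split /= sumr_const card_ord mulNrn; congr (_ - _); last by lia.
transitivity (\sum_(j < i.+1) (1 : int)); last first.
  by rewrite sumr_const card_ord natz.
rewrite (big_ord_widen n (fun=> 1 : int)) // [RHS]big_mkcond /=.
by apply: eq_bigr => j _; rewrite ltnS; case: (j <= i)%N.
Qed.

(** The increasing enumeration of the non-negative lifts. The quotient counts full turns, so cyclic
    indices become ordinary ones and a window is a difference of two values. *)
Definition lift_nth {R : realType} (x : nat -> circle R) (n k : nat) : R :=
  (sorted_coords x n)`_(k %% n)%N + (k %/ n)%:R.

Lemma is_lift_nth (R : realType) (x : nat -> circle R) n k :
  (0 < n)%N -> is_lift (coords x) n (lift_nth x n k).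
Proof.
move=> n0; apply: is_liftD; first by rewrite natr_int.
have [m mn ->] := nth_sorted_coords x (ltn_pmod k n0).
by exists m => //; rewrite /coords subrr rpred0.
Qed.

Lemma lift_count_nth (R : realType) (x : nat -> circle R) n k :
  injective x -> (0 < n)%N ->
  lift_count (coords x) n (lift_nth x n k) = k.+1%:Z - n%:Z.
Proof.
move=> xI n0; rewrite /lift_nth pmulrn lift_countD lift_count_sorted //.
  by have := divn_eq k n; lia.
by rewrite ltn_pmod.
Qed.

Lemma gap_lift_nth (R : realType) (x : nat -> circle R) n k :
  (0 < n)%N -> gap x n (k %% n)%N = lift_nth x n k.+1 - lift_nth x n k.
Proof.
move=> n0; rewrite /gap /lift_nth; have := ltn_pmod k n0.
have := divn_eq k n; move: (k %% n)%N (k %/ n)%N => b a -> ltbn.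
rewrite -addnS divnMDl // modnMDl; case: ifPn => [ltSb|].
  by rewrite modn_small // divn_small // addn0; ring.
rewrite -leqNgt => nb; have -> : b.+1 = n by lia.
by rewrite modnn divnn n0 natrD /=; ring.
Qed.

Lemma window_lift_nth (R : realType) (x : nat -> circle R) r n i :
  (0 < n)%N -> window x r n i = lift_nth x n (i + r) - lift_nth x n i.
Proof.
move=> n0; rewrite /window; elim: r => [|r IH].
  by rewrite big_ord0 addn0 subrr.
by rewrite big_ord_recr /= IH gap_lift_nth // addnS; ring.
Qed.

(** One index and one integer translation serve every [k], so both ends of a window are reached from
    the same starting place. *)
Lemma exists_lift (R : realType) (x : nat -> circle R) n (j : int) :
  injective x -> (0 < n)%N ->
  exists2 i : nat, (i < n)%N & exists a : int, forall k : nat,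
    let z := lift_nth x n (i + k) + a%:~R in
    is_lift (coords x) n z /\ lift_count (coords x) n z = j + k%:Z.
Proof.
move=> xI n0; have n0' : n%:Z != 0 by lia.
have n0z : 0 < n%:Z by lia.
(* [lift_nth x n k] has count [k + 1 - n], so count [j] sits at index [j + n - 1]; this is reduced
   modulo [n] and the quotient becomes the translation. *)
exists `|((j + n%:Z - 1) %% n%:Z)%Z|%N.
  by have := modz_ge0 (j + n%:Z - 1) n0'; have := ltz_pmod (j + n%:Z - 1) n0z; lia.
exists ((j + n%:Z - 1) %/ n%:Z)%Z => k z; split.
  by apply: is_liftD; [exact: intr_int|exact: is_lift_nth].
rewrite /z lift_countD lift_count_nth //.
have := modz_ge0 (j + n%:Z - 1) n0'; have := divz_eq (j + n%:Z - 1) n%:Z.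
lia.
Qed.

Lemma lift_window (R : realType) (x : nat -> circle R) r n a b :
  injective x -> (0 < n)%N ->
  is_lift (coords x) n a -> is_lift (coords x) n b ->
  lift_count (coords x) n b = lift_count (coords x) n a + r%:Z ->
  exists2 i, (i < n)%N & b - a = window x r n i.
Proof.
move=> xI n0 la lb ab.
have [i ltin [q iq]] := exists_lift (lift_count (coords x) n a) xI n0.
exists i => //; rewrite window_lift_nth //.
have [la' ca'] := iq 0%N; have [lb' cb'] := iq r.
rewrite addr0 addn0 in la' ca'.
rewrite (lift_count_inj lb lb') ?cb' // (lift_count_inj la la') ?ca' //; ring.
Qed.

Lemma le_max_window (R : realType) (x : nat -> circle R) r n a b :
  injective x -> (0 < n)%N ->
  is_lift (coords x) n a -> is_lift (coords x) n b ->
  lift_count (coords x) n b = lift_count (coords x) n a + r%:Z ->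
  b - a <= max_window x r n.
Proof.
move=> xI n0 la lb /(lift_window xI n0 la lb)[i ltin ->].
by rewrite /max_window (bigD1 (Ordinal ltin)) //= le_max lexx.
Qed.

Lemma min_window_le (R : realType) (x : nat -> circle R) r n a b :
  injective x -> (0 < n)%N ->
  is_lift (coords x) n a -> is_lift (coords x) n b ->
  lift_count (coords x) n b = lift_count (coords x) n a + r%:Z ->
  min_window x r n <= b - a.
Proof.
move=> xI n0 la lb /(lift_window xI n0 la lb)[i ltin ->].
by rewrite /min_window (bigD1 (Ordinal ltin)) //= ge_min lexx.
Qed.

Lemma min_window_gt0 (R : realType) (x : nat -> circle R) r n :
  injective x -> (0 < r)%N -> (0 < n)%N -> 0 < min_window x r n.
Proof.
move=> xI r0 n0; have window_gt0 i : 0 < window x r n i.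
  rewrite window_lift_nth // subr_gt0; apply: (@lift_of_count_lt _ (coords x) n).
  by rewrite !lift_count_nth //; lia.
rewrite /min_window; elim/big_ind: _ => // a b a0 b0.
by rewrite lt_min a0.
Qed.

(** Every window after the insertion lies inside a window before it, which starts at the last old
    lift not beyond [a]. *)
Lemma max_windowS (R : realType) (x : nat -> circle R) r n :
  injective x -> (0 < r)%N -> (0 < n)%N ->
  max_window x r n.+1 <= max_window x r n.
Proof.
move=> xI r0 n0; set c := coords x.
suff H i : window x r n.+1 i <= max_window x r n.
  rewrite /max_window; elim/big_ind: _ => // a b a0 b0.
  by rewrite ge_max a0.
rewrite window_lift_nth //.
set a := lift_nth _ _ i; set b := lift_nth _ _ (i + r).
have ab : lift_count c n.+1 b = lift_count c n.+1 a + r%:Z.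
  by rewrite /a /b /c !lift_count_nth //; lia.
have la : is_lift c n.+1 a by exact: is_lift_nth.
have lb : is_lift c n.+1 b by exact: is_lift_nth.
have ltab : a < b by apply: (@lift_of_count_lt _ c n.+1); lia.
have [i0 _ [q iq]] := exists_lift (lift_count c n a) xI n0.
have [la' ca'] := iq 0%N; have [lb' cb'] := iq r.
have := le_max_window xI n0 la' lb'; rewrite cb' ca' addr0 => /(_ _ erefl).
apply: le_trans; rewrite lerB //; last first.
  by apply: lift_of_count_le la' _; rewrite ca' addr0.
(* If [b] is a lift of the new point, fewer than [r] old lifts lie in []a, b]]; otherwise [b] is an
   old lift and there are at most [r] of them. *)
have [bZ|bnZ] := boolP (b - c n \is a Num.int).
  apply/ltW/(@lift_of_count_lt _ c n); rewrite cb'.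
  move: ab; rewrite !lift_countS.
  have : Num.floor (a - c n) < Num.floor (b - c n) by apply: floor_int_lt => //; lra.
  lia.
apply: lift_of_count_le (is_lift_old lb bnZ) _; rewrite cb'.
by have := lift_count_mono c (ltW ltab) (leqnSn n); lia.
Qed.

(** Laid end to end, [n] windows of [r] gaps go around the circle exactly [r] times. *)
Lemma max_window_ge (R : realType) (x : nat -> circle R) r n :
  injective x -> (0 < n)%N -> r%:R <= n%:R * max_window x r n.
Proof.
move=> xI n0; set M := max_window x r n.
have H k : lift_nth x n (r * k) - lift_nth x n 0 <= k%:R * M.
  elim: k => [|k IH]; first by rewrite muln0; lra.
  have : lift_nth x n (r * k.+1) - lift_nth x n (r * k) <= M.
    apply: le_max_window => //; try exact: is_lift_nth.
    by rewrite !lift_count_nth //; lia.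
  by rewrite -natr1; lra.
apply: le_trans (H n); rewrite /lift_nth modnMl mulnK // mod0n div0n; lra.
Qed.

(** * Neighbours of a lift, before and after an insertion *)

(* For y a lift, the i-th lift to its right (to its left if i < 0). *)
Definition neighbour {R : realType} (c : nat -> R) (n : nat) (y : R) (i : int) : R :=
  xget 0 [set z | is_lift c n z /\ lift_count c n z = lift_count c n y + i].

Lemma neighbourP (R : realType) (x : nat -> circle R) n y (i : int) :
  injective x -> (0 < n)%N ->
  is_lift (coords x) n (neighbour (coords x) n y i) /\
  lift_count (coords x) n (neighbour (coords x) n y i)
    = lift_count (coords x) n y + i.
Proof.
move=> xI n0; rewrite /neighbour; case: xgetP => // nz; exfalso.
have [j _ [a ja]] := exists_lift (lift_count (coords x) n y + i) xI n0.
by apply: (nz _); have := ja 0%N; rewrite addr0 => h; exact: h.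
Qed.

Lemma neighbour_eq (R : realType) (x : nat -> circle R) n y z (i : int) :
  injective x -> (0 < n)%N -> is_lift (coords x) n z ->
  lift_count (coords x) n z = lift_count (coords x) n y + i ->
  neighbour (coords x) n y i = z.
Proof.
move=> xI n0 lz cz; have [lq cq] := neighbourP y i xI n0.
by apply: lift_count_inj lq lz _; rewrite cq cz.
Qed.

Lemma neighbourD (R : realType) (x : nat -> circle R) n y (i a : int) :
  injective x -> (0 < n)%N ->
  neighbour (coords x) n (y + a%:~R) i = neighbour (coords x) n y i + a%:~R.
Proof.
move=> xI n0; have [lq cq] := neighbourP y i xI n0.
apply: neighbour_eq => //; first by apply: is_liftD => //; exact: intr_int.
by rewrite !lift_countD cq; ring.
Qed.

Lemma is_lift_new (R : realType) (c : nat -> R) n y :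
  y - c n \is a Num.int -> is_lift c n.+1 y.
Proof. by move=> yZ; exists n. Qed.

Lemma floor_add1 (R : realType) (z y : R) : y < z < y + 1 -> Num.floor (z - y) = 0.
Proof. by move=> /andP[? ?]; apply: floor_def; apply/andP; split; lra. Qed.

Lemma floor_sub1 (R : realType) (z y : R) :
  y - 1 < z < y -> Num.floor (z - y) = -1.
Proof.
move=> /andP[? ?]; apply: floor_def; rewrite addNr mulrN1z.
by apply/andP; split; lra.
Qed.

(** For [0 < |i| <= n] the neighbour is at distance strictly between 0 and 1 from [y], hence is an
    old lift. Before the insertion [y] holds no place of its own and shares the count of its left
    neighbour, whence the shift by 1 for [i < 0]. *)
Lemma neighbour_old (R : realType) (x : nat -> circle R) n y (i : int) :
  let c := coords x in
  let q := neighbour c n.+1 y in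
  injective x -> y - c n \is a Num.int ->
  i != 0 -> `|i| <= n%:Z ->
  is_lift c n (q i) /\
  lift_count c n (q i) = lift_count c n y + i + (if i < 0 then 1 else 0).
Proof.
move=> c q xI yZ i0; rewrite ler_norml => /andP[ni1 ni2]; have [lq cq] := neighbourP y i xI (ltn0Sn n).
rewrite -/c -/(q i) in lq cq.
have cD := lift_countD c n.+1 y 1; have cB := lift_countD c n.+1 y (-1).
have fl := floor_sub_lift (q i) yZ.
have qZ : Num.floor (q i - y) = (if i < 0 then -1 else 0) /\ q i != y /\
    -1 < q i - y < 1.
  have hD : q i < y + 1%:~R by apply: (@lift_of_count_lt _ c n.+1); rewrite cq cD; lia.
  have hB : y + (-1)%:~R < q i by apply: (@lift_of_count_lt _ c n.+1); rewrite ?cB cq; lia.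
  rewrite mulrN1z in hB; case: ifPn => [ineg|ipos].
    have h : q i < y by apply: (@lift_of_count_lt _ c n.+1); rewrite cq; lia.
    rewrite floor_sub1 ?h ?hB // lt_eqF //; do 2 split=> //.
    by apply/andP; split; lra.
  have h : y < q i by apply: (@lift_of_count_lt _ c n.+1); rewrite ?cB cq; lia.
  rewrite floor_add1 ?h ?hD // gt_eqF //; do 2 split=> //.
  by apply/andP; split; lra.
have [fq [qy /andP[q1 q2]]] := qZ; split; last first.
  by move: cq fl; rewrite !lift_countS fq; case: ifP => _; lia.
apply: is_lift_old lq _; apply/negP => qnZ.
have : q i - y \is a Num.int.
  rewrite (_ : q i - y = q i - c n - (y - c n)); last by ring.
  by rewrite rpredB.
rewrite intrEfloor fq => /eqP; case: ifP => _ /=; rewrite ?mulrN1z => h.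
  by move: q1; rewrite -h ltxx.
by move: qy; rewrite -subr_eq0 -h eqxx.
Qed.

(** * Gap lengths around an inserted point *)

(* The gap is a window of r gaps before the insertion, on which the new point
   lies, minus a window of r gaps after the insertion. *)
Lemma gap_near_insertion (R : realType) (x : nat -> circle R) (r n : nat) y
    (k : int) :
  let q := neighbour (coords x) n.+1 y in
  injective x -> (0 < n)%N -> (r <= n)%N -> y - coords x n \is a Num.int ->
  - r%:Z <= k < r%:Z ->
  q (k + 1) - q k <= max_window x r n - min_window x r n.+1.
Proof.
move=> q xI n0 rn yZ /andP[kr1 kr2]; set c := coords x.
have old (i : int) := @neighbour_old R x n y i xI yZ.
have P (i : int) := @neighbourP R x n.+1 y i xI (ltn0Sn n).
(* An old window straddling [y] spans [r + 1] places of the new numbering, since [y] occupies one of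
   them. *)
have big (i j : int) : i < 0 -> 0 < j -> j = i + r%:Z + 1 -> 
    q j - q i <= max_window x r n.
  move=> i0 j0 ji.
  have [||lj cj] := old j; try lia.
  have [||li ci] := old i; try lia.
  by apply: le_max_window => //; rewrite cj ci; do 2 case: ifP => //; lia.
have small (i : int) : min_window x r n.+1 <= q (i + r%:Z) - q i.
  have [li ci] := P i; have [lj cj] := P (i + r%:Z).
  by apply: min_window_le => //; rewrite cj ci; ring.
(* The subtracted window ends at [q k] if [0 <= k] and starts at [q (k + 1)] otherwise; in both
   cases the larger one straddles [y]. *)
have [k0|k0] := leP 0 k.
  have := small (k - r%:Z); rewrite subrK.
  by have := big (k - r%:Z) (k + 1) ltac:(lia) ltac:(lia) ltac:(lia); lra.
have := small (k + 1); have -> : k + 1 + r%:Z = k + r%:Z + 1 by ring.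
by have := big k (k + r%:Z + 1) ltac:(lia) ltac:(lia) ltac:(lia); lra.
Qed.

(** The window from [q (-1)] to [q (r - 1)] consists of the two halves of the split gap and [r - 2]
    further gaps, each bounded by [gap_near_insertion]. *)
Lemma split_gap_ge (R : realType) (x : nat -> circle R) (r n : nat) y :
  let q := neighbour (coords x) n.+1 y in
  injective x -> (2 <= r)%N -> (r <= n)%N -> y - coords x n \is a Num.int ->
  min_window x r n.+1 - (r%:R - 2) * (max_window x r n - min_window x r n.+1)
    <= q 1 - q (-1).
Proof.
move=> q xI r2 rn yZ; set D := _ - min_window x r n.+1.
have near t : (t < r)%N -> q t.+1%:Z - q 1 <= t%:R * D.
  elim: t => [|t IH] tr; first by rewrite subrr mul0r.
  have {}IH := IH (ltnW tr).
  have : q (t.+1%:Z + 1) - q t.+1%:Z <= D.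
    by apply: gap_near_insertion => //; lia.
  by rewrite (_ : t.+1%:Z + 1 = t.+2%:Z) -?natr1; [lra|lia].
have := near (r - 2)%N; rewrite natrB // => /(_ ltac:(lia)).
have [l1 c1] := @neighbourP R x n.+1 y (-1) xI (ltn0Sn n).
have [l2 c2] := @neighbourP R x n.+1 y (r - 2).+1%:Z xI (ltn0Sn n).
have := min_window_le xI (ltn0Sn n) l1 l2 (r := r).
rewrite c1 c2 => /(_ ltac:(lia)); rewrite -/(q (-1)) -/(q (r - 2).+1%:Z).
by lra.
Qed.

(** * Separation of good insertions *)

(** The ends of the old gap are still lifts at time [m], so the nearest neighbours of [y'] cannot
    lie beyond them. *)
Lemma gap_refine (R : realType) (x : nat -> circle R) n m y y' (k : int) :
  let q := neighbour (coords x) n y in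
  let q' := neighbour (coords x) m y' in
  injective x -> (0 < n)%N -> (n <= m)%N -> is_lift (coords x) m y' ->
  q k < y' < q (k + 1) -> q' 1 - q' (-1) <= q (k + 1) - q k.
Proof.
move=> q q'; rewrite /q /q' {q q'} => xI n0 nm ly' /andP[ky yk]; have m0 := leq_trans n0 nm.
have [lk _] := neighbourP y k xI n0; have [lk1 _] := neighbourP y (k + 1) xI n0.
have [l1 c1] := neighbourP y' 1 xI m0; have [l2 c2] := neighbourP y' (-1) xI m0.
rewrite lerB //.
  apply: lift_of_count_le l1 _; rewrite c1.
  by have := lift_count_lt (is_liftS nm lk1) yk; lia.
apply: lift_of_count_le (is_liftS nm lk) _; rewrite c2.
by have := lift_count_lt ly' ky; lia.
Qed.

(** Otherwise [y'] would fall strictly inside one of the [2r] gaps of length at most [tau], and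
    [gap_refine] would make the gap it splits that short. *)
Lemma insertion_outside (R : realType) (x : nat -> circle R) (r t t' : nat)
    y y' (tau : R) :
  let q := neighbour (coords x) t.+1 y in
  let q' := neighbour (coords x) t'.+1 y' in
  injective x -> (t < t')%N -> y - coords x t \is a Num.int ->
  y' - coords x t' \is a Num.int ->
  (forall k : int, - r%:Z <= k < r%:Z -> q (k + 1) - q k <= tau) ->
  tau < q' 1 - q' (-1) -> y' < q (- r%:Z) \/ q r%:Z < y'.
Proof.
move=> q q' xI tt' yZ yZ' gaps big.
have P (k : int) : is_lift (coords x) t.+1 (q k) /\
    lift_count (coords x) t.+1 (q k) = lift_count (coords x) t.+1 y + k.
  exact: neighbourP.
have neq k : y' != q k.
  apply/eqP => yk; apply: (lift_new (coords_incongruent xI) yZ').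
  by rewrite yk; apply: is_liftS (P k).1.
have [|h1] := ltP y' (q (- r%:Z)); first by left.
have [|h2] := ltP (q r%:Z) y'; first by right.
exfalso; pose k := lift_count (coords x) t.+1 y' - lift_count (coords x) t.+1 y.
have qk : q k <= y'.
  by apply: lift_of_count_le (P k).1 _; rewrite (P k).2 /k; lia.
have kq : y' < q (k + 1).
  by apply: (@lift_of_count_lt _ (coords x) t.+1); rewrite (P (k + 1)).2 /k; lia.
have kr : - r%:Z <= k.
  by have := lift_count_le (coords x) t.+1 h1; rewrite (P _).2 /k; lia.
have rk : k < r%:Z.
  have : y' < q r%:Z by rewrite lt_neqAle neq.
  by move/(lift_count_lt (P r%:Z).1); rewrite (P _).2 /k; lia.
have := @gap_refine R x t.+1 t'.+1 y y' k xI (ltn0Sn t) (ltnW tt') (is_lift_new yZ').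
rewrite -/q -/q' lt_neqAle eq_sym neq qk kq => /(_ isT).
by have := gaps k; rewrite kr rk => /(_ isT); lra.
Qed.

(** To the right of [q r], [y'] and all its right neighbours lie beyond [q i]. To the left of
    [q (- r)], at least [r + 1] lifts separate [y'] from [q i], more than [i']. *)
Lemma neighbours_disjoint (R : realType) (x : nat -> circle R)
    (r t t' i i' : nat) y y' (tau : R) :
  let q := neighbour (coords x) t.+1 y in
  let q' := neighbour (coords x) t'.+1 y' in
  injective x -> (t < t')%N -> y - coords x t \is a Num.int ->
  y' - coords x t' \is a Num.int ->
  (forall k : int, - r%:Z <= k < r%:Z -> q (k + 1) - q k <= tau) ->
  tau < q' 1 - q' (-1) -> (i <= r)%N -> (i' <= r)%N -> q i%:Z <> q' i'%:Z.
Proof.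
move=> q q' xI tt' yZ yZ' gaps big ir ir' qq'.
have P (k : int) : is_lift (coords x) t.+1 (q k) /\
    lift_count (coords x) t.+1 (q k) = lift_count (coords x) t.+1 y + k.
  exact: neighbourP.
have P' (k : int) : is_lift (coords x) t'.+1 (q' k) /\
    lift_count (coords x) t'.+1 (q' k) = lift_count (coords x) t'.+1 y' + k.
  exact: neighbourP.
have [] := insertion_outside xI tt' yZ yZ' gaps big => [y'q|qy'].
  have := lift_count_lt (is_liftS (ltnW tt' : (t.+1 <= t'.+1)%N) (P (- r%:Z)).1) y'q.
  have qrq : q (- r%:Z) <= q i%:Z.
    by apply: lift_of_count_le (P _).1 _; rewrite !(P _).2; lia.
  have := lift_count_mono (coords x) qrq (ltnW tt' : (t.+1 <= t'.+1)%N).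
  by rewrite !(P _).2 qq' (P' _).2; lia.
have : q i%:Z <= q r%:Z.
  by apply: lift_of_count_le (P _).1 _; rewrite !(P _).2; lia.
have : y' <= q' i'%:Z.
  by apply: lift_of_count_le (is_lift_new yZ') _; rewrite (P' _).2; lia.
by move=> /(lt_le_trans qy') /[swap] /le_lt_trans/[apply]; rewrite qq' ltxx.
Qed.

(** Each [t] in [A] claims [r + 1] of the [n] points, namely its own and the next [r] to the right
    at time [t + 1]; no point is claimed twice. *)
Lemma sparse_insertions (R : realType) (x : nat -> circle R) (r n : nat)
    (A : {set 'I_n}) (tau : R) :
  let q (t : nat) := neighbour (coords x) t.+1 in
  injective x -> (forall t, t \in A -> (r <= t)%N) ->
  (forall t y, t \in A -> y - coords x t \is a Num.int ->
    (forall k : int, - r%:Z <= k < r%:Z -> q t y (k + 1) - q t y k <= tau) /\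
    tau < q t y 1 - q t y (-1)) ->
  (#|A| * r.+1 <= n)%N.
Proof.
move=> q xI rA gapsA; set c := coords x.
pose f (p : 'I_n * 'I_r.+1) : 'I_n :=
  odflt p.1 [pick k : 'I_n | q p.1 (c p.1) (p.2 : nat)%:Z - c k \is a Num.int].
have fP (p : 'I_n * 'I_r.+1) :
    q p.1 (c p.1) (p.2 : nat)%:Z - c (f p) \is a Num.int.
  rewrite /f; case: pickP => //= none; exfalso.
  have [[k kt kZ] _] :=
    @neighbourP R x p.1.+1 (c p.1) (p.2 : nat)%:Z xI (ltn0Sn _).
  by have := none (Ordinal (leq_trans kt (ltn_ord p.1))); rewrite /= kZ.
suff finj : {in finset.setX A [set: 'I_r.+1]%SET &, injective f}.
  rewrite -[X in (_ * X)%N]card_ord -cardsT -cardsX -(card_in_imset finj).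
  by rewrite -[X in (_ <= X)%N]card_ord max_card.
have cZ t (a : int) : c t + a%:~R - c t \is a Num.int.
  by rewrite addrC addKr intr_int.
have diff p p' : f p = f p' -> exists a : int,
    q p.1 (c p.1) (p.2 : nat)%:Z = q p'.1 (c p'.1) (p'.2 : nat)%:Z + a%:~R.
  move=> ff; have := rpredB (fP p) (fP p'); rewrite ff => /intrP[a ha].
  by exists a; rewrite -ha; ring.
(* The two neighbours agree only modulo 1. The integer [a] is absorbed by translating the later base
   lift, which is why the gap hypotheses range over every lift [y]. *)
have off p p' : p.1 \in A -> p'.1 \in A -> (p.1 < p'.1)%N -> f p <> f p'.
  move=> pA p'A pp' /diff[a]; rewrite -[RHS]neighbourD //.
  have c0 : c p.1 - c p.1 \is a Num.int by rewrite subrr rpred0.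
  have [gaps _] := gapsA _ _ pA c0.
  have [_ big] := gapsA _ _ p'A (cZ p'.1 a).
  by apply: (neighbours_disjoint xI pp' c0 (cZ p'.1 a) gaps big);
    rewrite -ltnS.
move=> p p'; rewrite !inE !andbT => pA p'A ff.
have [pp'|pp'|/val_inj pp'] := ltngtP p.1 p'.1.
- by have := off _ _ pA p'A pp' ff.
- by have := off _ _ p'A pA pp' (esym ff).
(* For a common [t] the places differ by [a] times [t + 1] but by at most [r <= t], so [a = 0]. *)
have [a] := diff _ _ ff; rewrite -pp' => /(congr1 (lift_count c p.1.+1)).
rewrite lift_countD /q !(neighbourP _ _ xI _).2 // => h.
have := rA _ pA; have := ltn_ord p.2; have := ltn_ord p'.2.
have : a = 0 \/ 1 <= a \/ a <= -1 by lia.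
case: p p' pp' h {pA p'A ff} => [t i] [t' i'] /= <- h a3 ir ir' rt.
congr (_, _); apply: val_inj => /=; nia.
Qed.

(** * The limsup criterion and the choice of constants *)

Lemma le_limn_esup (R : realType) (u : nat -> R) (b : R) :
  1 < b ->
  (forall (rho : R) N, 1 <= rho -> rho < b ->
     ~ (forall n, (N <= n)%N -> u n <= rho)) ->
  (b%:E <= limn_esup (fun n => (u n)%:E))%E.
Proof.
move=> b1 H; rewrite leNgt; apply/negP => /ereal_inf_lt[_ [V [N _ NV] <-]].
set s := ereal_sup _ => sb.
have us n : (N <= n)%N -> ((u n)%:E <= s)%E.
  by move=> Nn; apply: ereal_sup_ubound; exists n => //; apply: NV.
case: s sb us => [s| |] //= sb us.
  (* The supremum of the tail may be below 1, while [rho] has to be at least 1. *)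
  apply: (H (Num.max 1 s) N) => [||n /us]; first by rewrite le_max lexx.
    by rewrite gt_max b1 -lte_fin.
  by rewrite lee_fin le_max => ->; rewrite orbT.
by apply: (H 1 N) => // n /us; rewrite leNgt ltNyr.
Qed.

Lemma exp_small (R : realType) (z e : R) :
  0 <= z -> z < 1 -> 0 < e -> exists k, z ^+ k < e.
Proof.
move=> z0 z1 e0; have := @cvg_expr R z; rewrite ger0_norm // => /(_ z1).
move=> /cvgr0Pnorm_lt/(_ _ e0)[k _ /(_ k (leqnn k))] /=.
by rewrite normrX ger0_norm //; exists k.
Qed.

Lemma ratio_constants (R : realType) (r : nat) (rho : R) :
  (2 <= r)%N -> 1 <= rho -> rho < 1 + r%:R / (r%:R ^+ 2 - 1) ->
  exists mu lam : R, [/\ 0 < mu < 1, rho * mu < 1, 0 < lam,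
    lam * (r%:R + 1) < r%:R &
    1 - mu < lam * (mu - (r%:R - 2) * (1 - mu))].
Proof.
move=> r2 rho1; have : 2 <= r%:R :> R by rewrite ler_nat.
move: (r%:R : R) => a a2; have a1 : 0 < a ^+ 2 - 1 by nra.
rewrite -ltrBlDl ltr_pdivlMr // => rhoa.
pose q := a ^+ 2 + a - 1; have q0 : 0 < q by rewrite /q; lra.
(* The claimed bound equals [q / (a ^+ 2 - 1)], which leaves room for [mu] between its inverse and
   [rho^-1]; the midpoint is taken, and likewise for [lam] below. *)
pose mu := ((a ^+ 2 - 1) / q + rho^-1) / 2.
have rho0 : 0 < rho by lra.
have lt_mu : (a ^+ 2 - 1) / q < rho^-1.
  by rewrite ltr_pdivrMr // mulrC ltr_pdivlMr // /q; lra.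
have mu1 : (a ^+ 2 - 1) < mu * q by rewrite -ltr_pdivrMr // /mu; lra.
have mu2 : rho * mu < 1 by rewrite mulrC -ltr_pdivlMr // div1r /mu; lra.
have mu0 : 0 < mu.
  by rewrite -(pmulr_lgt0 _ q0); lra.
have mu3 : mu < 1 by nra.
pose e := mu - (a - 2) * (1 - mu).
have d1 : (1 - mu) * q < a by rewrite /q in mu1 *; nra.
have e0 : 0 < e by rewrite /e /q in d1 *; nra.
(* This amounts to [(1 - mu) * (a ^+ 2 + 1) < a], which follows from [d1] because [a ^+ 2 + 1 <= q]
   for [2 <= a]. *)
have de : (1 - mu) * (a + 1) < a * e by rewrite /e /q in d1 *; nra.
have a0 : 0 < a + 1 by lra.
have lt_lam : (1 - mu) / e < a / (a + 1).
  by rewrite ltr_pdivrMr // mulrAC ltr_pdivlMr.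
pose lam := ((1 - mu) / e + a / (a + 1)) / 2.
have lam1 : 1 - mu < lam * e by rewrite -ltr_pdivrMr // /lam; lra.
exists mu, lam; split => //; first by rewrite mu0.
  by rewrite -(pmulr_lgt0 _ e0); lra.
by rewrite -ltr_pdivlMr // /lam; lra.
Qed.

(** * Counting good and bad steps *)

Lemma max_window_homo (R : realType) (x : nat -> circle R) r n m :
  injective x -> (0 < r)%N -> (0 < n)%N -> (n <= m)%N ->
  max_window x r m <= max_window x r n.
Proof.
move=> xI r0 n0; elim: m => [|m IH]; first by rewrite leqn0 => /eqP ->.
rewrite leq_eqVlt => /predU1P[-> //|]; rewrite ltnS => nm.
by apply: le_trans (IH nm); apply: max_windowS => //; apply: leq_trans nm.
Qed.

Lemma max_window_gt0 (R : realType) (x : nat -> circle R) r n :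
  injective x -> (0 < r)%N -> (0 < n)%N -> 0 < max_window x r n.
Proof.
move=> xI r0 n0; have := max_window_ge r xI n0.
have n0' : 0 < n%:R :> R by rewrite ltr0n.
by rewrite -(pmulr_rgt0 _ n0'); apply: lt_le_trans; rewrite ltr0n.
Qed.

Definition good_step {R : realType} (x : nat -> circle R) (r : nat) (mu : R)
    (t : nat) : bool :=
  mu * max_window x r t <= min_window x r t.+1.

(** The single threshold [(1 - mu) * max_window x r n0] serves all good steps: the nearby gaps stay
    below it since [max_window] decreases, and the split gap exceeds it since [max_window] has not
    yet fallen under the factor [lam]. *)
Lemma few_good_steps (R : realType) (x : nat -> circle R)
    (r n0 n : nat) (mu lam : R) :
  injective x -> (2 <= r)%N -> (r <= n0)%N -> mu <= 1 -> 0 < lam ->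
  1 - mu < lam * (mu - (r%:R - 2) * (1 - mu)) ->
  (forall t, (n0 <= t < n)%N -> lam * max_window x r n0 <= max_window x r t) ->
  ((\sum_(n0 <= t < n | good_step x r mu t) 1) * r.+1 <= n)%N.
Proof.
move=> xI r2 rn0 mu1 lam0 lamE largeM.
have r0 : (0 < r)%N by lia.
set e := _ - _ * _ in lamE.
have e0 : 0 < e by rewrite -(pmulr_rgt0 _ lam0); lra.
rewrite big_geq_mkord sum1dep_card.
apply: (@sparse_insertions _ x r n _ ((1 - mu) * max_window x r n0) xI) => [t|t y].
  by rewrite inE => /andP[_]; apply: leq_trans.
rewrite inE /good_step => /andP[good n0t] yZ.
have t0 : (0 < t)%N by lia.
have rt : (r <= t)%N by lia.
have Mt := max_window_homo xI r0 (leq_trans r0 rn0) n0t.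
have large := largeM t; rewrite n0t ltn_ord in large; have {large} large := large isT.
have M0 := max_window_gt0 xI r0 (leq_trans r0 rn0).
have a2 : 2 <= r%:R :> R by rewrite ler_nat.
split=> [k kr|].
  by apply: le_trans (gap_near_insertion xI t0 rt yZ kr) _; nra.
apply: lt_le_trans (split_gap_ge xI r2 rt yZ).
move: lamE good Mt large M0; rewrite /e.
set m' := min_window _ _ _; set M := max_window x r t; set M' := max_window _ _ _.
move=> lamE good Mt large M0.
have : (1 - mu) * M' < lam * e * M' by rewrite ltr_pM2r.
have : e * (lam * M') <= e * M by rewrite ler_pM2l.
have : (r%:R - 2) * (M - m') <= (r%:R - 2) * ((1 - mu) * M).
  by apply: ler_wpM2l; lra.
by rewrite /e; lra.
Qed.

(** A bad step gives [M_{t+1} <= rho * m_{t+1} <= rho * mu * M_t], and a good one does not increase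
    [M]. *)
Lemma bad_steps_decay (R : realType) (x : nat -> circle R)
    (r n0 n : nat) (mu rho : R) :
  injective x -> (0 < r)%N -> (0 < n0)%N -> 0 <= rho * mu -> 0 <= rho ->
  (n0 <= n)%N ->
  (forall t, (n0 <= t)%N -> max_window x r t <= rho * min_window x r t) ->
  max_window x r n <=
  (rho * mu) ^+ (\sum_(n0 <= t < n | ~~ good_step x r mu t) 1) *
    max_window x r n0.
Proof.
move=> xI r0 n00 rm0 rho0 + ratio; elim: n => [|n IH]; first by lia.
rewrite leq_eqVlt => /predU1P[<-|]; first by rewrite big_geq // mul1r.
rewrite ltnS => n0n; have {}IH := IH n0n.
rewrite big_mkcond big_nat_recr //= -big_mkcond /=.
have M1 := max_windowS xI r0 (leq_trans n00 n0n).
case: ifPn => [|_]; last by rewrite addn0; apply: le_trans IH.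
rewrite /good_step -ltNge => bad; rewrite addn1 exprS -mulrA.
apply: le_trans (ratio n.+1 (leqW n0n)) _.
apply: le_trans (_ : rho * mu * max_window x r n <= _); last by rewrite ler_wpM2l.
by rewrite -mulrA ler_wpM2l // ltW.
Qed.

(** If [M] stayed large, [G] good and [B < C] bad steps would satisfy [G * (r + 1) <= n] and
    [n = n0 + G + B], forcing [r * n <= (r + 1) * (n0 + C)]. *)
Lemma max_window_drops (R : realType) (x : nat -> circle R)
    (r n0 n C : nat) (mu lam rho : R) :
  injective x -> (2 <= r)%N -> (r <= n0)%N -> 0 < mu < 1 -> 1 <= rho ->
  rho * mu < 1 -> 0 < lam ->
  1 - mu < lam * (mu - (r%:R - 2) * (1 - mu)) ->
  (rho * mu) ^+ C < lam ->
  (forall t, (n0 <= t)%N -> max_window x r t <= rho * min_window x r t) ->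
  (r.+1 * (n0 + C) < r * n)%N ->
  max_window x r n < lam * max_window x r n0.
Proof.
move=> xI r2 rn0 /andP[mu0 mu1] rho1 rm1 lam0 lamE Clam ratio n0n.
have r0 : (0 < r)%N by lia.
have n00 : (0 < n0)%N by lia.
have le_n : (n0 <= n)%N by nia.
rewrite ltNge; apply/negP => large.
have rm0 : 0 <= rho * mu by apply: mulr_ge0; lra.
have large' t : (n0 <= t < n)%N -> lam * max_window x r n0 <= max_window x r t.
  move=> /andP[n0t tn]; apply: le_trans large _.
  by apply: max_window_homo => //; [lia|exact: ltnW].
have good := few_good_steps xI r2 rn0 (ltW mu1) lam0 lamE large'.
have rho0 : 0 <= rho by lra.
have bad := bad_steps_decay xI r0 n00 rm0 rho0 le_n ratio.
have nGB : (n - n0 = \sum_(n0 <= t < n | good_step x r mu t) 1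
    + \sum_(n0 <= t < n | ~~ good_step x r mu t) 1)%N.
  by rewrite -[LHS]muln1 -sum_nat_const_nat (bigID (good_step x r mu)).
move: good bad nGB; move: (\sum_(_ <= _ < _ | good_step _ _ _ _) _)%N => G.
move: (\sum_(_ <= _ < _ | ~~ _) _)%N => B good bad nGB.
have : lam <= (rho * mu) ^+ B.
  rewrite -(ler_pM2r (max_window_gt0 xI r0 n00)).
  exact: le_trans bad.
move=> lamB; have BC : (B < C)%N.
  rewrite ltnNge; apply/negP => CB.
  have := le_trans lamB (ler_wiXn2l rm0 (ltW rm1) CB).
  by rewrite leNgt Clam.
have : (r.+1 * n <= r.+1 * (n0 + G + B))%N.
  by rewrite leq_mul2l -addnA -nGB subnKC ?leqnn.
have : (r.+1 * B <= r.+1 * C)%N by rewrite leq_mul2l ltnW ?orbT.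
move: good n0n; clear; lia.
Qed.

(** * Iterating the drop against the lower bound for the largest window *)

Theorem theorem1p1 (R : realType) (r : nat) (hr : (2 <= r)%N)
    (x : nat -> circle R) (hx : injective x) :
  ((1 + r%:R / (r%:R ^+ 2 - 1))%:E
     <= limn_esup (fun n => (max_window x r n / min_window x r n)%:E))%E.
Proof.
have a2 : 2 <= r%:R :> R by rewrite ler_nat.
apply: le_limn_esup => [|rho N rho1 rhob ratio].
  by rewrite ltrDl divr_gt0 //; nra.
have r0 : (0 < r)%N by lia.
have [mu [lam [/andP[mu0 mu1] rm1 lam0 lamr lamE]]] := ratio_constants hr rho1 rhob.
have rm0 : 0 <= rho * mu by apply: mulr_ge0; lra.
have [C Clam] := exp_small rm0 rm1 lam0.
(* The least index at which [max_window_drops], started from [n], applies. *)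
pose g n := ((r.+1 * (n + C)) %/ r).+1.
have gP n : (r.+1 * (n + C) < r * g n <= r.+1 * (n + C) + r)%N.
  by rewrite /g [(r * _)%N]mulnC ltn_ceil //= mulSn addnC leq_add2r leq_trunc_div.
have g_gt n : (n < g n)%N.
  rewrite -(ltn_pmul2l r0); have /andP[h _] := gP n; apply: leq_ltn_trans h.
  exact: leq_mul (leqnSn _) (leq_addr _ _).
pose s k := iter k g (maxn N r).
have s_ge k : (maxn N r <= s k)%N.
  by elim: k => //= k IH; apply: leq_trans IH (ltnW (g_gt _)).
have s_gt0 k : (0 < s k)%N by apply: leq_trans (s_ge k); rewrite leq_max r0 orbT.
have ratio' k t : (s k <= t)%N -> max_window x r t <= rho * min_window x r t.
  move=> skt; have := s_ge k; rewrite geq_max => /andP[Ns rs].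
  have := ratio t (leq_trans Ns skt); rewrite ler_pdivrMr //.
  exact: min_window_gt0 hx r0 (leq_trans (s_gt0 k) skt).
have sM k : max_window x r (s k) <= lam ^+ k * max_window x r (s 0%N).
  elim: k => [|k IH]; first by rewrite mul1r.
  apply/ltW/(@lt_le_trans _ _ (lam * max_window x r (s k))).
    apply: (max_window_drops (mu := mu) (rho := rho) (C := C)) => //.
    - by have := s_ge k; rewrite geq_max => /andP[].
    - by rewrite mu0.
    - exact: ratio' k.
    - by have /andP[] := gP (s k).
  by rewrite exprS -mulrA ler_pM2l.
(* This shift absorbs the constants of the affine recurrence for [s], leaving pure growth by the
   factor [(r + 1) / r]. *)
pose K := (r.+1 * C + r)%N.
have sK k : r%:R ^+ k * (s k + K)%:R <= (r%:R + 1) ^+ k * (s 0%N + K)%:R :> R.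
  elim: k => [|k IH]; first by rewrite !mul1r.
  have : (r * (s k.+1 + K) <= r.+1 * (s k + K))%N.
    have /andP[_] : (_ < r * s k.+1 <= _)%N := gP (s k).
    by rewrite /K; move: (s k.+1) (s k); clear; lia.
  rewrite -(ler_nat R) !natrM -natr1 => h.
  rewrite exprSr -mulrA; apply: le_trans (ler_wpM2l _ h) _.
    by apply: exprn_ge0; lra.
  by rewrite mulrCA exprS -mulrA ler_wpM2l //; lra.
have M0 : 0 < max_window x r (s 0%N) by exact: max_window_gt0.
have z0 : 0 <= lam * (r%:R + 1) / r%:R by rewrite divr_ge0 ?mulr_ge0; lra.
have z1 : lam * (r%:R + 1) / r%:R < 1 by rewrite ltr_pdivrMr ?mul1r //; lra.
have sK0 : 0 < (s 0%N + K)%:R :> R.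
  by rewrite ltr0n addn_gt0 s_gt0.
(* At this [k] the decay [lam ^+ k] beats the growth of [s k], making [s k * max_window x r (s k)]
   less than 1, although it is at least [r]. *)
have [k] := exp_small z0 z1 (divr_gt0 ltr01 (mulr_gt0 sK0 M0)).
rewrite ltr_pdivlMr ?mulr_gt0 // expr_div_n exprMn.
have rk : 0 < r%:R ^+ k :> R by apply: exprn_gt0; lra.
rewrite mulrAC ltr_pdivrMr // mul1r => small.
have := max_window_ge r hx (s_gt0 k).
have Mk := max_window_gt0 hx r0 (s_gt0 k).
have h1 : (s k)%:R * max_window x r (s k) <= (s k + K)%:R * max_window x r (s k).
  by rewrite ler_pM2r // ler_nat leq_addr.
have h2 : r%:R ^+ k * (s k + K)%:R * max_window x r (s k) <=
    (r%:R + 1) ^+ k * (s 0%N + K)%:R * (lam ^+ k * max_window x r (s 0%N)).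
  by apply: ler_pM => //; exact: ltW.
move=> h3; have : r%:R ^+ k * r%:R < r%:R ^+ k :> R.
  apply: le_lt_trans small.
  pose lhs := r%:R ^+ k * ((s k + K)%:R * max_window x r (s k)).
  apply: (@le_trans _ _ lhs).
    by rewrite ler_pM2l //; lra.
  rewrite /lhs mulrA; apply: le_trans h2 _.
  by rewrite le_eqVlt; apply/orP; left; apply/eqP; ring.
by rewrite gtr_pMr //; lra.
Qed.
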